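(* Let $m \ge 2$ and $w_1,\ldots,w_m > 0$. For $\boldsymbol{z} \in \mathbb{R}^m$ let $A(\boldsymbol{z})$ denote the unique minimizer of $\sum_{j=1}^m w_j (z_j - f_j)^2$ over all $\boldsymbol{f} \in \mathbb{R}^m$ with $f_1 \ge f_2 \ge \cdots \ge f_m$, and let the partition corresponding to $A(\boldsymbol{z})$ be the partition of $\{1,\ldots,m\}$ into the maximal sets on which $i \mapsto A_i(\boldsymbol{z})$ is constant. Let $\boldsymbol{z} \in \mathbb{R}^m$, and let $P_1,\ldots,P_d$ be the blocks of the partition corresponding to $A(\boldsymbol{z})$, written as $P_s = \{b_{s-1}+1,\ldots,b_s\}$ with $0 = b_0 < b_1 < \cdots < b_d = m$. Let $j_o \in \{1,\ldots,m\}$, and let $\tilde{\boldsymbol{z}} \in \mathbb{R}^m$ satisfy $\tilde{z}_{j_o} > z_{j_o}$ and $\tilde{z}_j = z_j$ for all $j \ne j_o$. Let $s_o \in \{1,\ldots,d\}$ be the index with $j_o \in P_{s_o}$. Then the partition corresponding to $A(\tilde{\boldsymbol{z}})$ is a coarsening of the partition of $\{1,\ldots,m\}$ with the blocks $$P_s \ (1 \le s < s_o), \qquad \{b_{s_o-1}+1,\ldots,j_o\}, \qquad \{j\} \ (j_o < j \le b_{s_o}), \qquad P_s \ (s_o < s \le d).$$ Moreover, $A_i(\tilde{\boldsymbol{z}}) = A_i(\boldsymbol{z})$ for all $i > b_{s_o}$.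
   Context: $A_i(\boldsymbol{z})$ denotes the $i$-th component of $A(\boldsymbol{z})$. Since $A(\boldsymbol{z})$ is a non-increasing vector, its level sets are sets of consecutive indices, so the corresponding partition has the stated form. A partition $\mathcal{Q}$ is a coarsening of a partition $\mathcal{P}$ if every block of $\mathcal{P}$ is contained in a block of $\mathcal{Q}$ (with $\mathcal{Q} = \mathcal{P}$ allowed). *)

(* Defs.v *)
From HB Require Import structures.
From mathcomp Require Import all_boot all_order all_algebra.
From mathcomp Require Import boolp classical_sets functions reals.
From mathcomp Require Import interval_inference topology normedtype derive.
From mathcomp Require Import ring lra.

Set Implicit Arguments.
Unset Strict Implicit.
Unset Printing Implicit Defensive.

Import Order.TTheory GRing.Theory Num.Theory.
Import numFieldTopology.Exports numFieldNormedType.Exports.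

Local Open Scope ring_scope.

(* The index set {1, ..., m} is represented by 'I_m = {0, ..., m-1}: the
   1-based index i corresponds to the ordinal of value i - 1. *)

Definition nonincreasing_vec (R : realType) (m : nat) (f : 'rV[R]_m) : Prop :=
  forall i j : 'I_m, (i <= j)%N -> f 0 j <= f 0 i.

Definition wsqdist (R : realType) (m : nat) (w z f : 'rV[R]_m) : R :=
  \sum_(j < m) w 0 j * (z 0 j - f 0 j) ^+ 2.

Definition is_isoreg (R : realType) (m : nat) (w z f : 'rV[R]_m) : Prop :=
  nonincreasing_vec f /\
  forall g : 'rV[R]_m, nonincreasing_vec g -> wsqdist w z f <= wsqdist w z g.

(* The minimizer A(z), for the weights w; when all weights are positive,
   isoregP and isoreg_unique below show that it exists and is unique, so the
   default value 0 is not used. *)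
Definition isoreg (R : realType) (m : nat) (w z : 'rV[R]_m) : 'rV[R]_m :=
  xget 0 [set f | is_isoreg w z f]%classic.

Definition level_partition (R : realType) (m : nat) (f : 'rV[R]_m) :
    {set {set 'I_m}} :=
  preim_partition (fun i : 'I_m => f 0 i) [set: 'I_m].

Definition coarsening (T : finType) (Q P : {set {set T}}) : Prop :=
  forall B : {set T}, B \in P -> exists2 C : {set T}, C \in Q & B \subset C.

(* The block {b_s + 1, ..., b_(s+1)} in 1-based indices. *)
Definition block (m : nat) (b : nat -> nat) (s : nat) : {set 'I_m} :=
  [set i : 'I_m | (b s <= i < b s.+1)%N].

Definition blocks (m d : nat) (b : nat -> nat) : {set {set 'I_m}} :=
  [set block m b s | s : 'I_d].

(* The blocks before and after block so are kept; block so is cut into its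
   part up to and including jo, and singletons. *)
Definition split_blocks (m d : nat) (b : nat -> nat) (so : 'I_d) (jo : 'I_m) :
    {set {set 'I_m}} :=
  [set block m b s | s : 'I_d & (s < so)%N]
  :|: [set [set i : 'I_m | (b so <= i <= jo)%N]]
  :|: [set [set j] | j : 'I_m & (jo < j < b so.+1)%N]
  :|: [set block m b s | s : 'I_d & (so < s)%N].

Lemma isoreg_unique (R : realType) (m : nat) (w z : 'rV[R]_m)
    (w_gt0 : forall j : 'I_m, 0 < w 0 j)
    (f g : 'rV[R]_m) :
  is_isoreg w z f -> is_isoreg w z g -> f = g.
Proof.
move=> [mf Hf] [mg Hg].
have fg : wsqdist w z f = wsqdist w z g.
  by apply/eqP; rewrite eq_le Hf // Hg.
pose h : 'rV[R]_m := \row_j ((f 0 j + g 0 j) / 2).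
have mh : nonincreasing_vec h.
  move=> i j ij; rewrite !mxE; have := mf _ _ ij; have := mg _ _ ij; lra.
have := Hf h mh => fh.
have E : wsqdist w z f + wsqdist w z g - 2 * wsqdist w z h =
    \sum_(j < m) w 0 j * (f 0 j - g 0 j) ^+ 2 / 2.
  rewrite /wsqdist mulr_sumr -big_split -sumrB; apply: eq_bigr => j _ /=.
  by rewrite !mxE; field.
have S0 : \sum_(j < m) w 0 j * (f 0 j - g 0 j) ^+ 2 / 2 <= 0.
  by rewrite -E -fg; lra.
have P j : true -> 0 <= w 0 j * (f 0 j - g 0 j) ^+ 2 / 2.
  by move=> _; rewrite divr_ge0 // mulr_ge0 ?sqr_ge0 // ltW.
have /eqP := le_anti (introT andP (conj S0 (sumr_ge0 _ P))).
rewrite psumr_eq0 // => /allP H; apply/rowP => j.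
have /eqP := H j (mem_index_enum j).
move/eqP; rewrite !mulf_eq0 invr_eq0 pnatr_eq0 orbF gt_eqF //= orbb.
by rewrite subr_eq0 => /eqP.
Qed.

Lemma isoreg_exists (R : realType) (m : nat) (w z : 'rV[R]_m)
    (w_gt0 : forall j : 'I_m, 0 < w 0 j) :
  exists f : 'rV[R]_m, is_isoreg w z f.
Proof.
pose c0 := wsqdist w z 0.
have c0_ge0 : 0 <= c0.
  by apply: sumr_ge0 => j _; rewrite mulr_ge0 ?sqr_ge0 // ltW.
pose M := 1 + \sum_(j < m) (`|z 0 j| + c0 / w 0 j).
have term_ge0 (j : 'I_m) : 0 <= `|z 0 j| + c0 / w 0 j.
  by rewrite addr_ge0 // divr_ge0 // ltW.
have M_ge j : 1 + `|z 0 j| + c0 / w 0 j <= M.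
  rewrite /M (bigD1 j) //=.
  have : 0 <= \sum_(i < m | i != j) (`|z 0 i| + c0 / w 0 i).
    exact: sumr_ge0.
  lra.
pose K : set 'rV[R]_m :=
  ([set v : 'rV[R]_m | forall i, `[z 0 i - M, z 0 i + M]%classic (v 0 i)] `&`
   [set v : 'rV[R]_m | nonincreasing_vec v])%classic.
have cK : compact K.
  apply: compact_closedI.
    apply: (@rV_compact _ _ (fun i => `[z 0 i - M, z 0 i + M]%classic)).
    by move=> i; exact: segment_compact.
  have -> : [set v : 'rV[R]_m | nonincreasing_vec v]%classic =
    (\bigcap_(p in [set p : 'I_m * 'I_m | (p.1 <= p.2)%N])
       ((fun v : 'rV[R]_m => v 0 p.1 - v 0 p.2) @^-1` [set x | 0 <= x]))%classic.
    apply/seteqP; split => v /=.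
      by move=> mv [i j] /= ij; rewrite /= subr_ge0; exact: mv.
    by move=> mv i j ij; have := mv (i, j) ij; rewrite /= subr_ge0.
  apply: closed_bigI => p _; apply: preimage_closed; last exact: closed_ge.
  by move=> v _; apply: continuousB; exact: coord_continuous.
have K0 : K 0.
  split=> [i | i j _]; last by rewrite !mxE.
  rewrite /= in_itv /= mxE.
  have := M_ge i; have : 0 <= c0 / w 0 i by rewrite divr_ge0 // ltW.
  have := ler_norm (z 0 i); have := lerNnormlW (lexx `|z 0 i|).
  by move=> *; apply/andP; split; lra.
have cterm (j : 'I_m) :
    continuous (fun x : 'rV[R]_m => w 0 j * (z 0 j - x 0 j) ^+ 2).
  move=> v.
  have H : {for v, continuous (fun x : 'rV[R]_m => z 0 j - x 0 j)}.
    by apply: continuousB; [exact: cst_continuous | exact: coord_continuous].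
  have H2 : {for v, continuous (fun x : 'rV[R]_m => (z 0 j - x 0 j) ^+ 2)}.
    exact: (continuousM H H).
  exact: (continuousM (@cst_continuous _ _ (w 0 j) v) H2).
have cf : continuous (wsqdist w z).
  by apply: continuous_big => [|j _]; [exact: add_continuous | exact: cterm].
have [|f /set_mem [_ mf] fmin] :=
  compact_EVT_min _ cK (continuous_subspaceT cf); first by exists 0.
exists f; split=> // g mg.
have [gK|gK] := pselect (K g); first by apply: fmin; exact/mem_set.
apply: (le_trans (fmin 0 (mem_set K0))).
have [i Hi] : exists i, ~ `[z 0 i - M, z 0 i + M]%classic (g 0 i).
  by apply/existsNP => H; apply: gK.
have gi : M < `|z 0 i - g 0 i|.
  rewrite ltNge; apply/negP => H; apply: Hi; rewrite /= in_itv /=.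
  by move: H; rewrite ler_norml => /andP[*]; apply/andP; split; lra.
rewrite -/c0 /wsqdist (bigD1 i) //=.
have : 0 <= \sum_(j < m | j != i) w 0 j * (z 0 j - g 0 j) ^+ 2.
  by apply: sumr_ge0 => j _; rewrite mulr_ge0 ?sqr_ge0 // ltW.
suff : c0 <= w 0 i * (z 0 i - g 0 i) ^+ 2 by lra.
rewrite -real_normK ?num_real // mulrC -ler_pdivrMr //.
have := M_ge i; have := normr_ge0 (z 0 i).
have : 0 <= c0 / w 0 i by rewrite divr_ge0 // ltW.
move=> *; nra.
Qed.

Lemma isoregP (R : realType) (m : nat) (w z : 'rV[R]_m)
    (w_gt0 : forall j : 'I_m, 0 < w 0 j) :
  is_isoreg w z (isoreg w z).
Proof. exact: xgetPex (isoreg_exists z w_gt0). Qed.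

(* Main.v *)
(** Write [f = A(z)] and [g = A(z')]. Comparing with the pointwise minimum and
    maximum of [f] and [g] shows [f <= g]. The variational inequality at the
    minimizer says that the partial sums [sum_(j < k) w_j (z_j - f_j)] are
    nonpositive, and zero wherever [f] jumps between [k - 1] and [k] (and at
    [k = m]); likewise for [z'] and [g]. On the indices beyond the block of
    [jo], where [z' = z], this bounds the weighted sum of [g - f >= 0] by zero,
    so [g = f] there. If [g] had a jump at some [k <= jo] inside a level set of
    [f], the same argument on the indices before [k] would give [g = f] there,
    and the jump would push [g] below [f]. *)
Require Import Defs.
From mathcomp Require Import all_boot all_order all_algebra.
From mathcomp Require Import reals.
From mathcomp Require Import ring lra.

Set Implicit Arguments.
Unset Strict Implicit.

Import Order.TTheory GRing.Theory Num.Theory.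

Local Open Scope ring_scope.

(** The segment from [f] to [h] stays nonincreasing, and moving a fraction [t] along it changes the
    cost by [- 2 * t * P + t ^+ 2 * Q]; for [P > 0] this would be negative at small [t]. *)
Lemma isoreg_variational (R : realType) (m : nat) (w z f h : 'rV[R]_m)
    (w_gt0 : forall j : 'I_m, 0 < w 0 j) :
  is_isoreg w z f -> nonincreasing_vec h ->
  \sum_(j < m) w 0 j * (z 0 j - f 0 j) * (h 0 j - f 0 j) <= 0.
Proof.
move=> [mf fmin] mh.
set P := \sum_(j < m) _.
pose Q := \sum_(j < m) w 0 j * (h 0 j - f 0 j) ^+ 2.
have Q_ge0 : 0 <= Q.
  by apply: sumr_ge0 => j _; rewrite mulr_ge0 ?sqr_ge0 // ltW.
have step (t : R) : 0 <= t <= 1 -> 2 * t * P <= t ^+ 2 * Q.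
  move=> /andP[t0 t1].
  pose u : 'rV[R]_m := \row_j (f 0 j + t * (h 0 j - f 0 j)).
  have mu : nonincreasing_vec u.
    move=> i j ij; rewrite !mxE; have := mf _ _ ij; have := mh _ _ ij; nra.
  have := fmin u mu.
  suff -> : wsqdist w z u = wsqdist w z f - 2 * t * P + t ^+ 2 * Q by lra.
  rewrite /wsqdist /P /Q !mulr_sumr -sumrB -big_split /=.
  by apply: eq_bigr => j _; rewrite mxE; ring.
rewrite leNgt; apply/negP => P_gt0.
have PQ : 0 < P + Q by lra.
(* This [t] gives [t * Q = P - t * P < P], against [2 * P <= t * Q] from [step]; having [P + Q]
   below covers [Q = 0] and keeps [t <= 1]. *)
have [t [t_gt0 t_le1 tE]] : exists t, [/\ 0 < t, t <= 1 & t * (P + Q) = P].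
  exists (P / (P + Q)); rewrite divr_gt0 // divfK ?gt_eqF //.
  by split=> //; rewrite ler_pdivrMr //; lra.
have := step t; rewrite (ltW t_gt0) t_le1 => /(_ isT).
have := mulr_gt0 t_gt0 P_gt0.
rewrite expr2 [2 * _]mulrC -!mulrA ler_pM2l //.
nra.
Qed.

Lemma isoreg_mono (R : realType) (m : nat) (w z z' f g : 'rV[R]_m)
    (w_gt0 : forall j : 'I_m, 0 < w 0 j) :
  (forall j, z 0 j <= z' 0 j) -> is_isoreg w z f -> is_isoreg w z' g ->
  forall j, f 0 j <= g 0 j.
Proof.
move=> zz' [mf fmin] Ig; have [mg gmin] := Ig.
pose lo : 'rV[R]_m := \row_j Order.min (f 0 j) (g 0 j).
pose hi : 'rV[R]_m := \row_j Order.max (f 0 j) (g 0 j).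
have mlo : nonincreasing_vec lo.
  move=> i j ij; rewrite !mxE le_min !ge_min.
  by rewrite (mf _ _ ij) (mg _ _ ij) orbT.
have mhi : nonincreasing_vec hi.
  move=> i j ij; rewrite !mxE ge_max !le_max.
  by rewrite (mf _ _ ij) (mg _ _ ij) orbT.
(* Only indices with [g 0 j < f 0 j] matter: there the exchange changes the cost by [2 * w_j * (z_j
   - z'_j) * (f_j - g_j) <= 0]. *)
have swap : wsqdist w z lo + wsqdist w z' hi <= wsqdist w z f + wsqdist w z' g.
  rewrite /wsqdist -!big_split /=; apply: ler_sum => j _; rewrite !mxE.
  have := zz' j; have := w_gt0 j; case: (leP (f 0 j) (g 0 j)) => // gf wj zj.
  rewrite -!mulrDr ler_pM2l //; nra.
have Ihi : is_isoreg w z' hi.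
  split=> // h mh; have := fmin _ mlo; have := gmin _ mh; lra.
move=> j; rewrite -(isoreg_unique w_gt0 Ihi Ig) mxE.
by rewrite le_max lexx.
Qed.

(** Up to the factor -2, the derivative of the cost at [f] when the first [k] entries are raised
    together. *)
Definition residual (R : realType) (m : nat) (w z f : 'rV[R]_m) (k : nat) : R :=
  \sum_(j < m | (j < k)%N) w 0 j * (z 0 j - f 0 j).

Lemma residual_shift (R : realType) (m : nat) (w z f : 'rV[R]_m) (k : nat)
    (t : R) (w_gt0 : forall j : 'I_m, 0 < w 0 j) :
  is_isoreg w z f ->
  nonincreasing_vec (\row_j (f 0 j + (if (j < k)%N then t else 0))) ->
  residual w z f k * t <= 0.
Proof.
move=> If mh; have := isoreg_variational w_gt0 If mh.
rewrite /residual mulr_suml [X in _ -> X <= _]big_mkcond /=.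
congr (_ <= 0); apply: eq_bigr => j _; rewrite mxE.
by case: ifP => _; ring.
Qed.

Lemma residual_le0 (R : realType) (m : nat) (w z f : 'rV[R]_m) (k : nat)
    (w_gt0 : forall j : 'I_m, 0 < w 0 j) :
  is_isoreg w z f -> residual w z f k <= 0.
Proof.
move=> If; have [mf _] := If.
rewrite -[residual _ _ _ _]mulr1; apply: residual_shift => // i j ij.
rewrite !mxE lerD ?mf //.
case: (ltnP j k) => [jk|_]; first by rewrite (leq_ltn_trans ij jk).
by case: ifP.
Qed.

(** A jump at [k] leaves room to lower the first [k] entries slightly, which supplies the inequality
    opposite to [residual_le0]. *)
Lemma residual_jump (R : realType) (m : nat) (w z f : 'rV[R]_m) (k : nat)
    (w_gt0 : forall j : 'I_m, 0 < w 0 j) :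
  is_isoreg w z f ->
  (forall i j : 'I_m, (i < k <= j)%N -> f 0 j < f 0 i) ->
  residual w z f k = 0.
Proof.
move=> If jump; have [mf _] := If.
have [t t_gt0 tP] : exists2 t : R, 0 < t &
    forall i j : 'I_m, (i < k <= j)%N -> f 0 j + t <= f 0 i.
  (* For [k = 0] or [k >= m] no pair straddles [k], so any [t] works; otherwise the drop between the
     two neighbours of the cut does. *)
  case: k jump => [|k] jump; first by exists 1.
  have [km|mk] := ltnP k.+1 m; last first.
    exists 1 => // i j /andP[_ kj].
    by have := leq_trans mk kj; rewrite leqNgt ltn_ord.
  pose i0 := Ordinal (ltnW km); pose j0 := Ordinal km.
  have := jump i0 j0; rewrite /= leqnn => /(_ isT) f0.
  exists (f 0 i0 - f 0 j0); first by rewrite subr_gt0.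
  move=> i j /andP[ik kj].
  have := mf i i0 ik; have := mf j0 j kj; lra.
apply/eqP; rewrite eq_le residual_le0 //=.
have : residual w z f k * - t <= 0.
  apply: residual_shift => // i j ij; rewrite !mxE.
  have := mf _ _ ij; have := tP i j.
  case: (ltnP j k) => [jk|kj]; first by rewrite (leq_ltn_trans ij jk); lra.
  by case: ifP => _; [move=> /(_ isT); lra | lra].
by rewrite mulrN oppr_le0 pmulr_lge0.
Qed.

Lemma residual_tail (R : realType) (m : nat) (w z f : 'rV[R]_m) (k : nat)
    (w_gt0 : forall j : 'I_m, 0 < w 0 j) :
  is_isoreg w z f ->
  \sum_(j < m | (k <= j)%N) w 0 j * (z 0 j - f 0 j) = - residual w z f k.
Proof.
move=> If.
(* No index is [>= m], so the jump condition at [m] holds vacuously. *)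
have : residual w z f m = 0.
  apply: residual_jump => // i j /andP[_]; rewrite leqNgt ltn_ord //.
rewrite /residual (bigID (fun j : 'I_m => (j < k)%N)) /=.
under eq_bigl do rewrite ltn_ord.
under [X in _ + X]eq_bigl do rewrite ltn_ord -leqNgt.
by move/eqP; rewrite addrC addr_eq0 => /eqP.
Qed.

(** The difference of the two sums has the nonnegative terms [w_j * (g_j - f_j)], so all of them
    vanish. *)
Lemma eq_of_weighted_sum (R : realType) (m : nat) (w z f g : 'rV[R]_m)
    (P : pred 'I_m) (w_gt0 : forall j : 'I_m, 0 < w 0 j) :
  (forall j, f 0 j <= g 0 j) ->
  \sum_(j < m | P j) w 0 j * (z 0 j - f 0 j) <=
    \sum_(j < m | P j) w 0 j * (z 0 j - g 0 j) ->
  forall j, P j -> g 0 j = f 0 j.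
Proof.
move=> fg; rewrite -subr_le0 -sumrB => S0 j Pj.
have term_ge0 i : P i ->
    0 <= w 0 i * (z 0 i - f 0 i) - w 0 i * (z 0 i - g 0 i).
  by move=> _; have := fg i; have := w_gt0 i; nra.
have S_eq0 := le_anti (introT andP (conj S0 (sumr_ge0 _ term_ge0))).
have := psumr_eq0P term_ge0 S_eq0 Pj.
rewrite -mulrBr => /eqP; rewrite mulf_eq0 gt_eqF //= => /eqP; lra.
Qed.

Lemma nonincreasing_jump (R : realType) (m : nat) (g : 'rV[R]_m) (i j : 'I_m) :
  nonincreasing_vec g -> g 0 j < g 0 i ->
  exists2 k : nat, (i < k <= j)%N &
    forall i' j' : 'I_m, (i' < k <= j')%N -> g 0 j' < g 0 i'.
Proof.
move=> mg gji.
(* The jump is at the first index where [g] falls below [g 0 i]. *)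
case: (arg_minnP (P := fun k : 'I_m => g 0 k < g 0 i) (fun k => k : nat) gji).
move=> k gki kmin; exists k; first rewrite kmin // andbT ltnNge.
  by apply/negP => /mg; rewrite leNgt gki.
move=> i' j' /andP[i'k kj'].
apply: (le_lt_trans (mg _ _ kj')); apply: (lt_le_trans gki).
by rewrite leNgt; apply/negP => /kmin; rewrite leqNgt i'k.
Qed.

Lemma coarsening_level (R : realType) (m : nat) (g : 'rV[R]_m) (i0 : 'I_m)
    (P : {set {set 'I_m}}) :
  (forall B, B \in P -> forall i j : 'I_m, i \in B -> j \in B ->
     (i <= j)%N -> g 0 i = g 0 j) ->
  coarsening (level_partition g) P.
Proof.
move=> gP B BP.
pose C x := [set y in [set: 'I_m] | g 0 x == g 0 y].
have CP x : C x \in level_partition g by apply: imset_f; rewrite inE.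
have [x xB|B0] := pickP (mem B); last first.
  (* An empty [B] also needs a class containing it; that of [i0] serves. *)
  by exists (C i0) => //; apply/subsetP => y; have := B0 y => /= ->.
exists (C x) => //; apply/subsetP => y yB; rewrite !inE /=; apply/eqP.
have [xy|/ltnW yx] := leqP x y; first exact: (gP B).
by apply/esym/(gP B).
Qed.

Lemma level_partitionP (R : realType) (m : nat) (f : 'rV[R]_m) (i j : 'I_m) :
  f 0 i = f 0 j <->
  exists2 B : {set 'I_m}, B \in level_partition f & (i \in B) && (j \in B).
Proof.
split=> [fij|[_ /imsetP[x _ ->]]]; last first.
  by rewrite !inE /= => /andP[/eqP <- /eqP <-].
exists [set y in [set: 'I_m] | f 0 i == f 0 y].
  by apply: imset_f; rewrite inE.
by rewrite !inE /= fij eqxx.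
Qed.

Lemma breaks_mono (d : nat) (b : nat -> nat)
    (b_incr : forall s : nat, (s < d)%N -> (b s < b s.+1)%N) (s t : nat) :
  (s <= t <= d)%N -> (b s <= b t)%N.
Proof.
elim: t => [|t IH] /andP[]; first by rewrite leqn0 => /eqP ->.
rewrite leq_eqVlt => /predU1P[-> //|st] td.
by apply: leq_trans (ltnW (b_incr _ td)); rewrite IH // -ltnS st ltnW.
Qed.

Set Strict Implicit.
Unset Implicit Arguments.

Theorem mainTheorem3 (R : realType) (m : nat) (m_ge2 : (2 <= m)%N)
    (w : 'rV[R]_m) (w_gt0 : forall j : 'I_m, 0 < w 0 j)
    (z : 'rV[R]_m)
    (d : nat) (b : nat -> nat)
    (b_first : b 0%N = 0%N) (b_last : b d = m)
    (b_incr : forall s : nat, (s < d)%N -> (b s < b s.+1)%N)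
    (blocksP : level_partition (isoreg w z) = blocks m d b)
    (jo : 'I_m) (z' : 'rV[R]_m)
    (z'_jo : z 0 jo < z' 0 jo)
    (z'_other : forall j : 'I_m, j != jo -> z' 0 j = z 0 j)
    (so : 'I_d) (jo_so : jo \in block m b so) :
  coarsening (level_partition (isoreg w z')) (split_blocks b so jo) /\
  (forall i : 'I_m, (b so.+1 <= i)%N -> isoreg w z' 0 i = isoreg w z 0 i).
Proof.
have If := isoregP z w_gt0; have Ig := isoregP z' w_gt0.
move: (isoreg w z) (isoreg w z') If Ig blocksP => f g If Ig blocksP.
have [mf _] := If; have [mg _] := Ig.
have bmono := breaks_mono b_incr.
move: jo_so; rewrite inE => /andP[so_jo jo_so1].
have fg : forall j, f 0 j <= g 0 j.
  apply: (isoreg_mono w_gt0 _ If Ig) => j.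
  by have [->|/z'_other ->] := eqVneq j jo; first exact: ltW.
have f_block (s : 'I_d) i j :
    i \in block m b s -> j \in block m b s -> f 0 i = f 0 j.
  move=> ib jb; apply/level_partitionP; exists (block m b s).
    by rewrite blocksP; apply: imset_f.
  by rewrite ib jb.
have f_jump (i j : 'I_m) : (i < b so.+1 <= j)%N -> f 0 j < f 0 i.
  move=> /andP[ie ej]; rewrite lt_neqAle mf ?(ltnW (leq_trans ie ej)) // andbT.
  apply/eqP => /level_partitionP[B]; rewrite blocksP => /imsetP[t _ ->].
  (* A block [t <= so] ends too early to contain [j], and a block [t > so] starts too late to
     contain [i]. *)
  rewrite !inE => /andP[/andP[_ jt] /andP[ti _]].
  have [tso|sot] := leqP t so.
    have : (b t.+1 <= b so.+1)%N by rewrite bmono // ltnS tso ltn_ord.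
    by move=> /(leq_trans jt); rewrite ltnNge ej.
  have : (b so.+1 <= b t)%N by rewrite bmono // sot ltnW.
  by move=> /(leq_trans ie); rewrite ltnNge ti.
have tail (i : 'I_m) : (b so.+1 <= i)%N -> g 0 i = f 0 i.
  apply: (eq_of_weighted_sum (w := w) (z := z) (P := fun i : 'I_m => (b so.+1 <= i)%N)) => //.
  rewrite residual_tail // residual_jump // oppr0.
  have : 0 <= - residual w z' g (b so.+1) by rewrite oppr_ge0 residual_le0.
  rewrite -residual_tail //; congr (_ <= _); apply: eq_bigr => j ej.
  by rewrite z'_other // neq_ltn (leq_trans jo_so1 ej) orbT.
have head (i j : 'I_m) :
    (i <= j)%N -> (j <= jo)%N -> f 0 i = f 0 j -> g 0 i = g 0 j.
  move=> ij jjo fij; apply/eqP; rewrite eq_le (mg _ _ ij) andbT leNgt.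
  apply/negP => gji; have [k /andP[ik kj] kjump] := nonincreasing_jump mg gji.
  suff gi : g 0 i = f 0 i by have := fg j; lra.
  apply: (eq_of_weighted_sum (w := w) (z := z) (P := fun i : 'I_m => (i < k)%N)) ik => //.
  (* The residual of [g] at [k] is zero by the jump, and it involves only indices
     [l < k <= j <= jo], where [z'] and [z] agree. *)
  apply: (le_trans (residual_le0 k w_gt0 If)).
  have /eqP := residual_jump w_gt0 Ig kjump; rewrite eq_le => /andP[_].
  congr (_ <= _); apply: eq_bigr => l lk; rewrite z'_other // neq_ltn.
  by rewrite (leq_trans lk) // (leq_trans kj).
split=> //; apply: (coarsening_level jo) => B.
(* Blocks before [so] and the piece ending at [jo] lie in the range of [head]; later blocks lie in
   that of [tail]. *)
rewrite !inE -!orbA => /or4P[/imsetP[s]|/eqP->|/imsetP[l _ ->]|/imsetP[s]].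
- rewrite inE => sso -> i j ib jb ij; apply: head => //; last exact: (f_block s).
  move: jb; rewrite inE => /andP[_ js].
  apply: leq_trans (ltnW js) (leq_trans _ so_jo).
  by rewrite bmono // sso ltnW.
- move=> i j; rewrite !inE => /andP[bi ijo] /andP[bj jjo] ij.
  apply: head => //; apply: (f_block so); rewrite inE.
    by rewrite bi (leq_ltn_trans ijo).
  by rewrite bj (leq_ltn_trans jjo).
- by move=> i j /set1P-> /set1P->.
rewrite inE => sos -> i j ib jb _; rewrite !tail ?(f_block s i j) //.
  move: jb; rewrite inE => /andP[bj _]; apply: leq_trans bj.
  by rewrite bmono // sos ltnW.
move: ib; rewrite inE => /andP[bi _]; apply: leq_trans bi.
by rewrite bmono // sos ltnW.
Qed.
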